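(* Let $G$ be a finite connected graph (loops and multiple edges allowed) with $n$ vertices, maximal degree $d$, and girth $g$. Then \[ \mathrm{kiss}(G) \leq \frac{n d (d-1)^{\lfloor g/2 \rfloor}}{g}, \] with equality if and only if $G$ is a Moore graph.
   Context: A walk is a finite sequence of oriented edges in which the initial vertex of each edge after the first equals the terminal vertex of the previous one; it is closed if it starts and ends at the same vertex, and closed walks are considered up to cyclic permutation of their edges. A walk is geodesic if it never traverses an edge and immediately traverses the same edge back in the opposite direction; a closed geodesic is a closed walk that is locally geodesic (including at the base point). A cycle is a closed walk in which each vertex is the initial vertex of at most one edge of the walk. The girth of $G$ is the smallest length of a closed geodesic in $G$ (a shortest closed geodesic is a cycle). The kissing number $\mathrm{kiss}(G)$ is the number of distinct shortest oriented cycles in $G$ (oriented cycles of length equal to the girth). A Moore graph is a connected $d$-regular graph of girth $g$ whose number of vertices equals the Moore bound, namely $1 + d \sum_{j=0}^{(g-3)/2} (d-1)^j$ if $g$ is odd and $2 \sum_{j=0}^{(g-2)/2} (d-1)^j$ if $g$ is even. *)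

(* Defs.v *)
From mathcomp Require Import all_boot all_order all_algebra.
Set Implicit Arguments. Unset Strict Implicit. Unset Printing Implicit Defensive.

(* A finite graph (loops and multiple edges allowed) in Serre's convention:
   a finite vertex type V, a finite type D of oriented edges (darts),
   src : D -> V (initial vertex) and a fixed-point-free involution
   rev : D -> D (reversal of orientation).  Each geometric edge (including
   each loop) gives exactly two oriented edges. *)
Section Graph.
Variables (V D : finType) (src : D -> V) (rev : D -> D).

Definition tgt (e : D) : V := src (rev e).

(* degree of a vertex = number of oriented edges starting at it
   (a loop contributes 2) *)
Definition deg (v : V) : nat := #|[set e | src e == v]|.
Definition maxdeg : nat := \max_(v : V) deg v.
Definition regular (k : nat) : Prop := forall v : V, deg v = k.

Definition adj : rel V := fun u v => [exists e, (src e == u) && (tgt e == v)].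
Definition connected : Prop := forall u v : V, connect adj u v.

(* closed walk (up to cyclic permutation, represented by a sequence) *)
Definition closed_walk (s : seq D) : bool :=
  (s != [::]) && cycle (fun a b => tgt a == src b) s.
Definition closed_geodesic (s : seq D) : bool :=
  (s != [::]) && cycle (fun a b => (tgt a == src b) && (b != rev a)) s.
Definition is_cycle (s : seq D) : bool := closed_walk s && uniq (map src s).

Definition is_girth (g : nat) : Prop :=
  (exists s, closed_geodesic s /\ size s = g) /\
  (forall s, closed_geodesic s -> g <= size s).

Definition shortest_cycle (g : nat) (t : g.-tuple D) : bool :=
  is_cycle t && closed_geodesic t.

(* kissing number: number of distinct shortest oriented cycles, i.e. of
   classes of such sequences under cyclic permutation *)
Definition kiss (g : nat) : nat :=
  #|[set [set rot_tuple i t | i : 'I_g] | t in [set t : g.-tuple D | shortest_cycle t]]|.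

Definition moore_bound (k g : nat) : nat :=
  if odd g then 1 + k * \sum_(j < (g - 1) %/ 2) (k - 1) ^ j
  else 2 * \sum_(j < g %/ 2) (k - 1) ^ j.

Definition is_moore : Prop :=
  connected /\ exists k g, regular k /\ is_girth g /\ #|V| = moore_bound k g.
End Graph.

(* Main.v *)
(* Let g be the girth and r = floor(g/2). Two distinct non-backtracking walks with
   the same ends have total length at least g, since otherwise they would produce
   a closed geodesic shorter than g. Hence a shortest closed geodesic, based at one
   of its edges, is determined by its first r + 1 edges: the other g - r - 1 < g/2
   edges are the unique such way back. There are g kiss(G) based shortest
   geodesics, and at most n d (d-1)^r non-backtracking walks of length r + 1.
   Equality holds iff G is d-regular and every non-backtracking walk of length
   r + 1 extends to a shortest cycle. Going around that cycle the other way, this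
   says that the tree of short walks around any vertex (g odd) or edge (g even),
   whose ends are distinct and whose size is the Moore bound, is closed under
   adjacency, i.e. exhausts the connected graph G. *)
Require Import Defs.
From mathcomp Require Import all_boot all_order all_algebra.
From mathcomp Require Import zify.
Import Order.TTheory GRing.Theory Num.Theory.

Section KissingNumber.
Set Implicit Arguments. Unset Strict Implicit. Unset Printing Implicit Defensive.
Local Open Scope nat_scope.

Variables (V D : finType) (src : D -> V) (bar : D -> D).
Hypotheses (barK : involutive bar) (bar_neq : forall e, bar e != e).
Local Notation tgt := (tgt src bar).
Local Notation closed_geodesic := (closed_geodesic src bar).

(** * Non-backtracking walks and their reversal *)

Definition out (u : V) : {set D} := [set h | src h == u].
Definition succ (e : D) : {set D} := out (tgt e) :\ bar e.
Definition nb : rel D := fun a b => (tgt a == src b) && (b != bar a).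
(** The set [A] constrains the first edge: [out u] for walks based at [u], [succ e] for
    continuations of [e], [setT] for no constraint. *)
Definition nbwalk (A : {set D}) (w : seq D) : bool :=
  if w is h :: w' then (h \in A) && path nb h w' else true.
Definition endv (u : V) (w : seq D) : V := last u (map tgt w).
Definition inv (w : seq D) : seq D := map bar (rev w).

Lemma tgt_bar e : tgt (bar e) = src e.
Proof. by rewrite /Defs.tgt barK. Qed.

Lemma mem_succ a b : (b \in succ a) = nb a b.
Proof. by rewrite !inE /nb andbC eq_sym. Qed.

Lemma nb_bar a b : nb (bar b) (bar a) = nb a b.
Proof.
by rewrite /nb tgt_bar barK eq_sym [bar a == b]eq_sym.
Qed.

Lemma path_nb e w : path nb e w = nbwalk (succ e) w.
Proof. by case: w => //= h w; rewrite mem_succ. Qed.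

Lemma nbwalk_cat A h p q :
  nbwalk A ((h :: p) ++ q) = nbwalk A (h :: p) && nbwalk (succ (last h p)) q.
Proof. by rewrite /= cat_path [path _ _ q]path_nb andbA. Qed.

Lemma nbwalk_rcons A p l :
  nbwalk A (rcons p l) =
  nbwalk A p && (l \in if p is h :: p' then succ (last h p') else A).
Proof. by case: p => [|h p]; rewrite /= ?andbT // rcons_path mem_succ andbA. Qed.

Lemma endv_rcons u p l : endv u (rcons p l) = tgt l.
Proof. by rewrite /endv map_rcons last_rcons. Qed.

Lemma endv_cons u h p : endv u (h :: p) = tgt (last h p).
Proof. by rewrite /endv /= last_map. Qed.

Lemma endv_cat u p q : endv u (p ++ q) = endv (endv u p) q.
Proof. by rewrite /endv map_cat last_cat. Qed.

Lemma succ_src e h : h \in succ e -> src h = tgt e.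
Proof. by rewrite mem_succ => /andP[/eqP]. Qed.

Lemma nbwalk_succ e p : nbwalk (succ e) p -> nbwalk (out (tgt e)) p.
Proof. by case: p => //= h p /andP[/succ_src He ->]; rewrite inE He eqxx. Qed.

Lemma nbwalk_belast u p l :
  nbwalk (out u) (rcons p l) -> nbwalk (out u) p /\ endv u p = src l.
Proof.
rewrite nbwalk_rcons => /andP[-> Hl]; split=> //.
case: p Hl => [|h p]; last by move/succ_src->; rewrite endv_cons.
by rewrite inE => /eqP.
Qed.

Lemma size_inv w : size (inv w) = size w.
Proof. by rewrite size_map size_rev. Qed.

Lemma inv_cons h p : inv (h :: p) = rcons (inv p) (bar h).
Proof. by rewrite /inv rev_cons map_rcons. Qed.

Lemma inv_rcons p l : inv (rcons p l) = bar l :: inv p.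
Proof. by rewrite /inv rev_rcons. Qed.

Lemma nbwalk_inv u w : nbwalk (out u) w -> nbwalk (out (endv u w)) (inv w).
Proof.
case: w => //= h p /andP[_ Hp].
rewrite endv_cons lastI inv_rcons /= inE eqxx /=.
rewrite path_map -(eq_path (e := fun z => nb^~ z)) ?rev_path // => x y.
by rewrite /= nb_bar.
Qed.

Lemma endv_inv u w : nbwalk (out u) w -> endv (endv u w) (inv w) = u.
Proof.
case: w => //= h p /andP[]; rewrite inE => /eqP Hh _.
by rewrite inv_cons endv_rcons tgt_bar.
Qed.

Lemma cycle_cat (T : Type) (e : rel T) x p y s :
  cycle e ((x :: p) ++ y :: s) =
  [&& path e x p, e (last x p) y, path e y s & e (last y s) x].
Proof. by rewrite /= rcons_cat cat_path /= rcons_path. Qed.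

Lemma closed_geodesic_inv w : closed_geodesic (inv w) = closed_geodesic w.
Proof.
rewrite /Defs.closed_geodesic -/nb; congr (_ && _).
  by rewrite -!size_eq0 size_inv.
rewrite /inv cycle_map rev_cycle; apply: eq_cycle => x y; exact: nb_bar.
Qed.

Lemma geodesic_nbwalk h p : closed_geodesic (h :: p) ->
  [/\ nbwalk (out (src h)) (h :: p), endv (src h) (h :: p) = src h
    & nb (last h p) h].
Proof.
rewrite /Defs.closed_geodesic -/nb /= rcons_path => /andP[Hp Hl].
by rewrite endv_cons inE eqxx Hp Hl; split=> //; apply/eqP; case/andP: Hl.
Qed.

(** * Uniqueness of walks that are short compared with the girth *)

Section Girth.
Variable g : nat.
Hypothesis girth : is_girth src bar g.

Lemma short_not_geodesic s : size s < g -> ~~ closed_geodesic s.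
Proof. by case: girth => _ H; apply: contraTN => /H; rewrite leqNgt. Qed.

(* If the closed walk [p ++ inv q] backtracks, it does so only at one of its two
   junctions; cancelling there gives a shorter such pair. *)
Lemma geodesic_pair u p q :
  nbwalk (out u) p -> nbwalk (out u) q -> endv u p = endv u q -> p != q ->
  size p + size q <= g -> closed_geodesic (p ++ inv q).
Proof.
have [n] := ubnP (size p + size q); elim: n u p q => // n IH u p q Hn Hp Hq Hend pq le_g.
(* By induction, a strictly shorter pair would close up to a geodesic of length below [g]. *)
have red u' p' q' : nbwalk (out u') p' -> nbwalk (out u') q' ->
    endv u' p' = endv u' q' -> p' != q' -> size p' + size q' < size p + size q -> False.
  move=> Hp' Hq' He ne lt.
  have lt_g := leq_trans lt le_g.
  apply/(negP (short_not_geodesic (s := p' ++ inv q') _)).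
    by rewrite size_cat size_inv.
  by apply: (IH u') => //; [exact: leq_trans lt _ | exact: ltnW].
(* This serves the pairs with an empty member. If the last edge reverses the first, stripping both
   leaves a walk that [red] compares with the empty one; a single edge is excluded by [bar_neq]. *)
have closed s : nbwalk (out u) s -> endv u s = u -> s != [::] ->
    size s <= size p + size q -> closed_geodesic s.
  case: s => [//|h s] Hs Es _ le_s.
  rewrite /Defs.closed_geodesic -/nb /= rcons_path.
  have /andP[Hh Hs'] := Hs; rewrite Hs' /=.
  move: Hh Es; rewrite inE endv_cons => /eqP Hh El.
  rewrite /nb El Hh eqxx /=; apply/negP => /eqP Hl.
  case: (lastP s) Hs' El Hl le_s {Hs} => [_ _ /= Hl|s' l].
    by have := bar_neq h; rewrite -Hl eqxx.
  rewrite last_rcons rcons_path => /andP[Hs' /andP[/eqP El' nl]] El Hl le_s.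
  have Dl : l = bar h by rewrite Hl barK.
  apply: (red (tgt h) s' [::]) => //.
  - by apply: nbwalk_succ; rewrite -path_nb.
  - rewrite [RHS]/= -[RHS]/(src (bar h)) -Dl -El'.
    by case: (s') => //= a b; exact: endv_cons.
  - by apply/eqP => s0; move: nl; rewrite s0 /= Dl eqxx.
  - by move: le_s; rewrite /= size_rcons addn0; apply: leq_trans.
case: p q => [|h p] [|k q] //= in Hp Hq Hend pq le_g red closed Hn *.
- by rewrite closed_geodesic_inv; apply: closed => //; rewrite ?add0n -?Hend.
- by rewrite cats0; apply: closed; rewrite ?addn0.
have := nbwalk_inv (Hq : nbwalk (out u) (k :: q)).
have Einv : inv (k :: q) = bar (last k q) :: inv (belast k q).
  by rewrite lastI inv_rcons.
rewrite Einv => /andP[_ Hi]; rewrite /Defs.closed_geodesic -/nb.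
rewrite -[h :: _]/((h :: p) ++ _) cycle_cat Hi /=.
have -> : last (bar (last k q)) (inv (belast k q)) = bar k.
  by rewrite -[LHS]/(last (bar k) (_ :: _)) -Einv inv_cons last_rcons.
move: (Hp) (Hq) => /andP[Hh Hp'] /andP[Hk Hq'].
move: Hh Hk; rewrite !inE => /eqP Hh /eqP Hk.
rewrite Hp' /= /nb tgt_bar Hh Hk eqxx barK.
move: (Hend); rewrite !endv_cons => Hl; rewrite -[src (bar _)]/(tgt _) Hl eqxx /=.
(* Backtracking at the far junction means equal last edges, at the base equal first edges. *)
apply/andP; split; apply/negP => /eqP E.
- have {}E := inv_inj barK E.
  move: Hp Hq pq; rewrite -/(nbwalk (out u) (h :: p)) -/(nbwalk (out u) (k :: q)).
  rewrite !lastI E eqseq_rcons eqxx andbT.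
  move=> /nbwalk_belast[Hp E1] /nbwalk_belast[Hq E2] ne.
  apply: (red u _ _ Hp Hq) => //; first by rewrite E1.
  by rewrite !size_belast; lia.
- apply: (red (tgt h) p q) => //; last by lia.
  + by apply: nbwalk_succ; rewrite -path_nb.
  + by apply: nbwalk_succ; rewrite -path_nb E.
  + by rewrite /endv -[LHS]/(endv u (h :: p)) Hend E.
  + by move: pq; rewrite E eqseq_cons eqxx.
Qed.

Lemma short_unique u p q :
  nbwalk (out u) p -> nbwalk (out u) q -> endv u p = endv u q ->
  size p + size q < g -> p = q.
Proof.
move=> Hp Hq He lt; apply/eqP; apply: contraT => ne.
have := short_not_geodesic (s := p ++ inv q).
rewrite size_cat size_inv => /(_ lt) /negP[].
exact: (geodesic_pair Hp Hq He ne (ltnW lt)).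
Qed.

Lemma girth_gt0 : 0 < g.
Proof. by case: girth => -[s [Hs <-]] _; case: s Hs. Qed.

Lemma girth_darts : exists a b : D, b \in succ a.
Proof.
case: girth => -[s [Hs _]] _; case: s Hs => [//|h s] Hs.
by exists (last h s), h; case/geodesic_nbwalk: Hs; rewrite mem_succ.
Qed.

Lemma nbwalk_catl A p q : nbwalk A (p ++ q) -> nbwalk A p.
Proof. by case: p => // h p; rewrite nbwalk_cat => /andP[]. Qed.

(** A repeated vertex would cut off a nonempty closed segment shorter than [g], which [short_unique]
    identifies with the empty walk. *)
Lemma geodesic_is_cycle c : closed_geodesic c -> size c = g -> is_cycle src bar c.
Proof.
move=> Hc Sc; have /andP[c0 Cc] := Hc; apply/andP; split.
  by rewrite /closed_walk c0; apply: sub_cycle Cc => a b /andP[].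
have x0 : D by case: (c) c0.
apply: contraT => /(uniqPn (src x0)) [i [j [ij]]]; rewrite size_map => jc Eij.
have ic := ltn_trans ij jc.
rewrite !(nth_map x0) // in Eij.
have : closed_geodesic (rot i c).
  by rewrite /Defs.closed_geodesic -/nb rot_cycle -size_eq0 size_rot size_eq0.
(* The segment between positions [i] and [j] comes first, followed by the [j]-th edge, whose source
   closes it. *)
have -> : rot i c =
    rcons (take (j - i) (drop i c)) (nth x0 c j) ++ (drop j.+1 c ++ take i c).
  rewrite cat_rcons /rot -cat_cons -drop_nth // catA; congr (_ ++ _).
  by rewrite -{1}[drop i c](cat_take_drop (j - i)) drop_drop subnK // ltnW.
case Ec1: (take _ _) => [|h c1].
  move/(congr1 size): Ec1; rewrite size_take size_drop /=; case: ifP; lia.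
have Dh : h = nth x0 c i.
  have := congr1 (nth x0 ^~ 0) Ec1; rewrite /= nth_take ?subn_gt0 // nth_drop addn0 //.
move=> /geodesic_nbwalk[Hr _ _].
have [Hn He] := nbwalk_belast (nbwalk_catl
  (Hr : nbwalk _ (rcons (h :: c1) (nth x0 c j) ++ _))).
have := short_unique Hn (isT : nbwalk (out (src h)) [::]).
rewrite He -Eij -Dh addn0 => /(_ erefl) H.
suff : false by []; suff : h :: c1 = [::] by [].
apply: H; rewrite -Ec1 size_take size_drop; case: ifP; lia.
Qed.

(** * Based shortest geodesics and the kissing number *)

Definition geodesics : {set g.-tuple D} := [set t : g.-tuple D | closed_geodesic t].

(** A shortest geodesic is a cycle, so its [g] rotations start with distinct edges and each class
    has exactly [g] members. *)
Lemma kiss_geodesics : kiss src bar g * g = #|geodesics|.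
Proof.
have g0 := girth_gt0.
rewrite /kiss; set S := [set t : g.-tuple D | shortest_cycle src bar t].
have -> : S = geodesics.
  apply/setP => t; rewrite !inE /shortest_cycle.
  case: (boolP (closed_geodesic t)); rewrite ?andbF ?andbT //.
  by move=> Ht; rewrite geodesic_is_cycle ?size_tuple.
pose f (t : g.-tuple D) := [set rot_tuple i t | i : 'I_g]; rewrite -/f.
have cf t : t \in geodesics -> #|f t| = g.
  rewrite inE => Ht; have /andP[_ /map_uniq Ut] := geodesic_is_cycle Ht (size_tuple t).
  have [x0 _] := girth_darts.
  rewrite card_imset ?card_ord // => i j.
  move=> /(congr1 (fun s : g.-tuple D => nth x0 s 0)) /=; rewrite /rot !nth_cat.
  rewrite !size_drop !size_tuple !subn_gt0 !ltn_ord !nth_drop !addn0.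
  by move/eqP; rewrite nth_uniq ?size_tuple // => /eqP /val_inj.
have fS t i : t \in geodesics -> rot_tuple i t \in geodesics.
  by rewrite !inE /Defs.closed_geodesic -!size_eq0 size_rot rot_cycle.
rewrite -[RHS]sum1_card (partition_big_imset f) /= -sum_nat_const.
apply: eq_bigr => A /imsetP[t0 Ht0 ->].
(* The fibre of [f] over the class of [t0] is that class itself. *)
rewrite -[LHS](cf _ Ht0) -sum1_card; apply: eq_bigl => t.
apply/imsetP/andP => [[i _ ->] | [Ht /eqP Ef]]; last first.
  suff : t \in f t by rewrite Ef => /imsetP.
  by apply/imsetP; exists (Ordinal g0) => //; apply: val_inj; rewrite /= rot0.
split; first exact: fS.
rewrite eqEcard !cf ?fS // leqnn andbT; apply/subsetP => _ /imsetP[j _ ->].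
(* The index [g] is not in ['I_g], but rotation by [g] is rotation by 0. *)
have im k : k <= g -> rot_tuple k t0 \in f t0.
  rewrite leq_eqVlt => /orP[/eqP-> | lt]; last by apply/imsetP; exists (Ordinal lt).
  apply/imsetP; exists (Ordinal g0) => //; apply: val_inj.
  by rewrite /= rot0 -{1}(size_tuple t0) rot_size.
have -> : rot_tuple j (rot_tuple i t0) =
    rot_tuple (if j + i <= g then j + i else j + i - g) t0.
  by apply: val_inj; rewrite /= rot_add_mod ?size_tuple // ltnW.
by apply: im; have := ltn_ord i; have := ltn_ord j; case: ifP; lia.
Qed.

(** The last conclusion expresses that the geodesic does not backtrack at its base point: [q] read
    backwards leaves the start of [h] by an edge other than [h]. *)
Lemma geodesic_split h p q : closed_geodesic ((h :: p) ++ q) ->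
  [/\ nbwalk (out (src h)) (h :: p), nbwalk (succ (last h p)) q,
      endv (tgt (last h p)) q = src h
    & nbwalk (succ (bar h)) (inv q)].
Proof.
move=> H; have [] := geodesic_nbwalk H.
rewrite nbwalk_cat => /andP[Hp Hq] He Hl; split=> //.
  by move: He; rewrite -[h :: _]/((h :: p) ++ q) endv_cat endv_cons.
rewrite -path_nb; suff : nbwalk (out (tgt (last h p))) (rcons q h).
  by move/nbwalk_inv; rewrite inv_rcons /= => /andP[].
by apply: nbwalk_succ; rewrite -path_nb rcons_path path_nb Hq /= -last_cat.
Qed.

(** With r = [g %/ 2], the two remainders have the same ends and total length 2(g - r - 1) < g. *)
Lemma geodesic_take_inj s t : closed_geodesic s -> closed_geodesic t ->
  size s = g -> size t = g ->
  take (g %/ 2).+1 s = take (g %/ 2).+1 t -> s = t.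
Proof.
move=> Hs Ht Ss St E; have g0 := girth_gt0.
rewrite -(cat_take_drop (g %/ 2).+1 s) -(cat_take_drop (g %/ 2).+1 t) -E in Hs Ht *.
case Ep: (take _ s) => [|h p] in Hs Ht *.
  by move/(congr1 size): Ep; rewrite size_take Ss /=; case: ifP; lia.
have [_ /nbwalk_succ Hs1 Hs2 _] := geodesic_split Hs.
have [_ /nbwalk_succ Ht1 Ht2 _] := geodesic_split Ht.
rewrite (short_unique Hs1 Ht1) ?Hs2 ?Ht2 // !size_drop Ss St; lia.
Qed.


(** * Counting non-backtracking walks *)

Fixpoint walks (n : nat) (A : {set D}) : seq (seq D) :=
  if n is n'.+1 then [seq h :: w | h <- enum A, w <- walks n' (succ h)] else [:: [::]].

Lemma mem_walks n A w : (w \in walks n A) = (size w == n) && nbwalk A w.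
Proof.
elim: n A w => [|n IH] A w /=; first by rewrite inE -size_eq0; case: w.
apply/allpairsPdep/andP => [[h [p [Hh Hp ->]]] | []].
  by move: Hh Hp; rewrite mem_enum IH /= eqSS path_nb => -> /andP[-> ->].
case: w => [//|h p]; rewrite /= eqSS path_nb => Sp /andP[Hh Hp].
by exists h, p; rewrite mem_enum IH Hh Sp.
Qed.

Lemma walks_uniq n A : uniq (walks n A).
Proof.
elim: n A => [//|n IH] A /=; apply: allpairs_uniq_dep => //; first exact: enum_uniq.
by move=> [a p] [b q] _ _ /= [-> ->].
Qed.

Lemma size_walksS n A : size (walks n.+1 A) = \sum_(h in A) size (walks n (succ h)).
Proof. by rewrite size_allpairs_dep sumnE big_map big_enum. Qed.

Lemma card_succ e : #|succ e| = deg src (tgt e) - 1.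
Proof.
have := cardsD1 (bar e) (out (tgt e)).
by rewrite -/(deg src (tgt e)) -/(succ e) inE -/(tgt e) eqxx => ->; rewrite addKn.
Qed.

Local Notation d := (maxdeg src).

Lemma card_succ_le e : #|succ e| <= d - 1.
Proof. by rewrite card_succ leq_sub2r // /maxdeg (leq_bigmax (F := deg src)). Qed.

(** The first edge is free in [A]; each later one has at most [d - 1] choices. *)
Lemma size_walks_le n A : size (walks n.+1 A) <= #|A| * (d - 1) ^ n.
Proof.
have le k e : size (walks k (succ e)) <= (d - 1) ^ k.
  elim: k e => [//|k IH] e.
  rewrite size_walksS (leq_trans (leq_sum _ (fun h _ => IH h))) //.
  by rewrite sum_nat_const expnS leq_mul2r card_succ_le orbT.
by rewrite size_walksS -sum_nat_const leq_sum.
Qed.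

Lemma size_walks k n A : regular src k -> size (walks n.+1 A) = #|A| * (k - 1) ^ n.
Proof.
move=> reg; have E m e : size (walks m (succ e)) = (k - 1) ^ m.
  elim: m e => [//|m IH] e; rewrite size_walksS (eq_bigr _ (fun h _ => IH h)).
  by rewrite sum_nat_const expnS card_succ reg.
by rewrite size_walksS (eq_bigr _ (fun h _ => E n h)) sum_nat_const.
Qed.

(** The empty walk is included: it accounts for the base vertex, the leading 1 of the odd Moore
    bound. *)
Fixpoint ball (n : nat) (A : {set D}) : seq (seq D) :=
  if n is n'.+1 then ball n' A ++ walks n A else walks 0 A.

Lemma mem_ball n A w : (w \in ball n A) = (size w <= n) && nbwalk A w.
Proof.
elim: n => [|n IH]; first by rewrite mem_walks leqn0.
by rewrite mem_cat IH mem_walks -andb_orl [in RHS]leq_eqVlt ltnS orbC.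
Qed.

Lemma ball_uniq n A : uniq (ball n A).
Proof.
elim: n => [|n IH]; first exact: walks_uniq.
rewrite [ball _ _]/= cat_uniq IH (walks_uniq n.+1) andbT /=; apply/hasPn => w.
by rewrite (mem_walks n.+1) mem_ball => /andP[/eqP-> _]; rewrite ltnn.
Qed.

Lemma size_ball k n A : regular src k ->
  size (ball n A) = 1 + #|A| * \sum_(j < n) (k - 1) ^ j.
Proof.
move=> reg; elim: n => [|n IH]; first by rewrite big_ord0 muln0.
by rewrite [ball _ _]/= size_cat IH (size_walks n A reg) big_ord_recr mulnDr addnA.
Qed.

(** * The upper bound and its equality case *)

Lemma card_darts : #|D| = \sum_u deg src u.
Proof.
rewrite -sum1_card (partition_big src predT) //=; apply: eq_bigr => u _.
by rewrite /deg -sum1_card; apply: eq_bigl => e; rewrite !inE.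
Qed.

Lemma regular_maxdeg k : 0 < #|V| -> regular src k -> d = k.
Proof.
move=> V0 reg; rewrite /maxdeg (eq_bigr _ (fun u _ => reg u)) big_const.
by case: #|V| V0 => // m _; elim: m => [|m IH]; [exact: maxn0 | rewrite iterS IH maxnn].
Qed.

Lemma card_darts_le : #|D| <= #|V| * d.
Proof.
rewrite card_darts -sum_nat_const leq_sum // => u _.
exact: (leq_bigmax (F := deg src)).
Qed.

Lemma card_darts_eq : #|D| = #|V| * d <-> regular src d.
Proof.
split=> [E u|reg]; last first.
  by rewrite card_darts (eq_bigr _ (fun u _ => reg u)) sum_nat_const.
have le u' : deg src u' <= d by exact: (leq_bigmax (F := deg src)).
have := leqif_sum (I := V) (P := predT) (fun i _ => leqif_eq (le i)).
case=> _; rewrite -card_darts E sum_nat_const eqxx => /esym/forallP/(_ u).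
by move/eqP.
Qed.

(** Besides regularity, this is the condition for equality in the count of geodesics. *)
Definition extendable : Prop := forall w,
  size w = (g %/ 2).+1 -> nbwalk setT w ->
  exists q, closed_geodesic (w ++ q) /\ size (w ++ q) = g.

(** By [geodesic_take_inj] there are as many of these as based geodesics. *)
Let prefixes : seq (seq D) := [seq take (g %/ 2).+1 t | t : g.-tuple D in geodesics].

Lemma prefixes_uniq : uniq prefixes.
Proof.
rewrite map_inj_in_uniq ?enum_uniq // => s t; rewrite !mem_enum !inE => Hs Ht.
by move/(geodesic_take_inj Hs Ht (size_tuple _) (size_tuple _))/val_inj.
Qed.

Lemma prefixes_sub : {subset prefixes <= walks (g %/ 2).+1 setT}.
Proof.
have g0 := girth_gt0.
move=> _ /mapP[t + ->]; rewrite mem_enum inE => Ht; rewrite mem_walks.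
rewrite size_takel ?size_tuple ?eqxx; last by lia.
apply: (@nbwalk_catl _ _ (drop (g %/ 2).+1 t)); rewrite cat_take_drop.
by case: (tval t) Ht => // h s /geodesic_nbwalk[/andP[_ Hs] _ _]; rewrite /= Hs inE.
Qed.

Lemma extendableP : extendable <-> {subset walks (g %/ 2).+1 setT <= prefixes}.
Proof.
split=> [ext w | sub w Sw Hw].
  rewrite mem_walks => /andP[/eqP Sw Hw].
  have [q [Hq /eqP Sq]] := ext w Sw Hw.
  apply/mapP; exists (Tuple Sq); first by rewrite mem_enum inE.
  by rewrite /= take_size_cat.
have /mapP[t] : w \in prefixes by apply: sub; rewrite mem_walks Sw eqxx.
rewrite mem_enum inE => Ht Ew; exists (drop (g %/ 2).+1 t).
by rewrite {1 2}Ew cat_take_drop size_tuple.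
Qed.

(** This makes the power of [d - 1] positive, so that it can be cancelled in the equality case. *)
Lemma maxdeg_gt1 : 1 < d.
Proof.
have [a [b Hb]] := girth_darts.
have := card_succ_le a; have : 0 < #|succ a| by apply/card_gt0P; exists b.
by move=> /leq_trans H /H; rewrite subn_gt0.
Qed.

(** Prefixes are among the walks of length r + 1, these number at most [#|D|] times (d - 1)^r, and
    [#|D|] is at most [#|V| * d]. Equality in the last comparison is regularity, which makes the
    middle one an equality too; equality in the first says that every walk is a prefix. *)
Lemma card_geodesics :
  #|geodesics| <= #|V| * d * (d - 1) ^ (g %/ 2) ?= iff
    (#|D| == #|V| * d) && all [in prefixes] (walks (g %/ 2).+1 setT).
Proof.
have e0 : 0 < (d - 1) ^ (g %/ 2) by rewrite expn_gt0 subn_gt0 maxdeg_gt1.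
have le1 := uniq_leq_size prefixes_uniq prefixes_sub.
have le2 := size_walks_le (g %/ 2) setT.
have le3 := card_darts_le; rewrite -(leq_pmul2r e0) in le3.
rewrite cardsT in le2; have Sp : size prefixes = #|geodesics| by rewrite size_map cardE.
rewrite Sp in le1; have le23 := leq_trans le2 le3; split; first exact: leq_trans le1 le23.
apply/eqP/andP => [E | [/eqP ED /allP sub]].
  split; first by rewrite -(eqn_pmul2r e0) eqn_leq le3 -E (leq_trans le1 le2).
  rewrite -E -Sp in le23; have [_ Eq] := uniq_min_size prefixes_uniq prefixes_sub le23.
  by apply/allP => w; rewrite Eq.
have reg := card_darts_eq.1 ED.
apply/eqP; rewrite eqn_leq (leq_trans le1 le23) -Sp.
by rewrite -ED -[#|D|]cardsT -(size_walks _ _ reg) uniq_leq_size ?walks_uniq.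
Qed.


(** * The Moore tree: size, distinctness of its ends, and when it exhausts the graph *)

Lemma endv_ball_uniq n u (A : {set D}) : A \subset out u -> n + n < g ->
  uniq (map (endv u) (ball n A)).
Proof.
move=> sA lt; have sub p : nbwalk A p -> nbwalk (out u) p.
  by case: p => //= h p /andP[/(subsetP sA)-> ->].
rewrite map_inj_in_uniq ?ball_uniq // => p q.
rewrite !mem_ball => /andP[Sp /sub Hp] /andP[Sq /sub Hq] E.
exact: short_unique Hp Hq E (leq_ltn_trans (leq_add Sp Sq) lt).
Qed.

(* Endpoints, with multiplicity, of the short geodesics issuing from the initial
   vertex of [e] (odd girth) or from both ends of [e] and avoiding [e] (even
   girth): the tree whose size is the Moore bound. *)
Definition moore_tree (e : D) : seq V :=
  if odd g then map (endv (src e)) (ball (g %/ 2) (out (src e)))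
  else map (endv (tgt e)) (ball (g %/ 2).-1 (succ e)) ++
       map (endv (tgt (bar e))) (ball (g %/ 2).-1 (succ (bar e))).

Lemma even_half_gt0 : ~~ odd g -> 0 < g %/ 2.
Proof. by have := girth_gt0; lia. Qed.

(** For even [g], suppose both halves share an end. Prefixing [e] to the walk beyond [e] gives two
    walks from [src e] of total length at most g - 1, hence equal; but the other one does not start
    with [e]. *)
Lemma moore_tree_uniq e : uniq (moore_tree e).
Proof.
rewrite /moore_tree; case: ifPn => [og | eg].
  by apply: endv_ball_uniq; last lia.
have r0 := even_half_gt0 eg.
rewrite cat_uniq !endv_ball_uniq ?subsetDl //=; try lia.
rewrite andbT; apply/hasPn => _ /mapP[q + ->].
rewrite mem_ball => /andP[Sq Hq]; apply/negP => /mapP[p].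
rewrite mem_ball => /andP[Sp Hp] E.
have He : nbwalk (out (src e)) (e :: p) by rewrite /= inE eqxx path_nb.
have Hq' := nbwalk_succ Hq; rewrite tgt_bar in Hq' E.
have Eq : e :: p = q.
  apply: (short_unique He Hq'); first by rewrite E.
  by rewrite /=; move: (size p) (size q) Sp Sq => i j; lia.
by move: Hq; rewrite -Eq /= !inE barK eqxx.
Qed.

Lemma size_moore_tree k e : regular src k -> size (moore_tree e) = moore_bound k g.
Proof.
move=> reg; rewrite /moore_tree /moore_bound; case: ifPn => [og | eg].
  rewrite size_map (size_ball _ _ reg) -/(deg src (src e)) reg.
  by have -> : (g - 1) %/ 2 = g %/ 2 by lia.
rewrite size_cat !size_map !(size_ball _ _ reg) !card_succ !reg.
(* The term j = 0 of the bound is the root of each half. *)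
rewrite -[in RHS](prednK (even_half_gt0 eg)) big_ord_recl addnn -mul2n.
congr (2 * (1 + _)); rewrite big_distrr /=.
by apply: eq_bigr => i _; rewrite -expnS.
Qed.

(** The ends are distinct, so the tree covers as many vertices as its size. *)
Lemma moore_tree_full k e : regular src k ->
  #|V| = moore_bound k g <-> forall y, y \in moore_tree e.
Proof.
move=> reg; rewrite -(size_moore_tree e reg) -(card_uniqP (moore_tree_uniq e)).
split=> [E y | full].
  have /subset_cardP H : #|moore_tree e| = #|V| by [].
  by rewrite (H (subset_predT _)).
by apply: eq_card => y; rewrite full.
Qed.

(** Moving on to a neighbour either lengthens the walk or undoes its last edge. *)
Lemma nbwalk_step u p h : nbwalk (out u) p -> endv u p = src h ->
  nbwalk (out u) (rcons p h) \/ exists p', p = rcons p' (bar h).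
Proof.
case: p => [|k p] Hp; first by rewrite /= inE => <-; left; rewrite eqxx.
rewrite endv_cons nbwalk_rcons Hp mem_succ /nb => ->; rewrite eqxx /=.
case: eqP => [-> | _]; [right | by left].
by exists (belast k p); rewrite barK -lastI.
Qed.

(* Closing a geodesic up to a shortest cycle gives a short way back to its end. *)
Lemma extend_back h p : extendable -> nbwalk (out (src h)) (h :: p) ->
  size p = g %/ 2 -> exists s, [/\ nbwalk (succ (bar h)) s,
    endv (src h) s = tgt (last h p) & size s = g - (g %/ 2).+1].
Proof.
move=> ext /= /andP[_ Hp] Sp.
have [||q [Hq Sq]] := ext (h :: p); rewrite /= ?inE ?Sp //.
have [_ /nbwalk_succ Hq1 Hq2 Hq3] := geodesic_split Hq.
exists (inv q); split=> //; first by rewrite -Hq2 endv_inv.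
by move: Sq; rewrite size_inv size_cat /= Sp; lia.
Qed.

(** Below maximal length the walk is extended by [h] or retracts. At maximal length [extend_back]
    goes around a shortest cycle the other way: this takes r edges for odd [g], and for even [g] r -
    1 edges that avoid the central edge, hence a walk of the other half. *)
Lemma moore_tree_closed e h : extendable ->
  src h \in moore_tree e -> tgt h \in moore_tree e.
Proof.
move=> ext; rewrite /moore_tree; case: ifPn => [og | eg].
  case/mapP=> p; rewrite mem_ball => /andP[Sp Hp] /esym He.
  have [Hph | [p' Ep]] := nbwalk_step Hp He; last first.
    rewrite Ep in Hp Sp; have [Hp' Ep'] := nbwalk_belast Hp.
    apply/mapP; exists p'; last by rewrite Ep'.
    by rewrite mem_ball Hp'; move: Sp; rewrite size_rcons => /ltnW->.
  move: Sp; rewrite leq_eqVlt => /orP[/eqP Sp | Sp]; last first.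
    by apply/mapP; exists (rcons p h); rewrite ?endv_rcons // mem_ball size_rcons Sp.
  case Ep : (rcons p h) Hph => [|k q] Hph; first by case: (p) Ep.
  have Hk : src k = src e by case/andP: Hph; rewrite inE => /eqP.
  rewrite -Hk in Hph; have [|s [Hs Es Ss]] := extend_back ext Hph.
    by move/(congr1 size): Ep; rewrite size_rcons Sp /= => -[].
  apply/mapP; exists s.
    move/nbwalk_succ: Hs; rewrite tgt_bar mem_ball Hk Ss => ->; rewrite andbT; lia.
  by rewrite -Hk Es -[tgt h](endv_rcons (src e) p) Ep endv_cons.
have r0 := even_half_gt0 eg.
(* Here [a] is [e] or [bar e]. Prefixing [a] to the walk treats the cancellation of [a] itself,
   which crosses to the other half, like any other. *)
have half a p : src h = endv (tgt a) p -> p \in ball (g %/ 2).-1 (succ a) ->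
    tgt h \in map (endv (tgt a)) (ball (g %/ 2).-1 (succ a)) \/
    tgt h \in map (endv (src a)) (ball (g %/ 2).-1 (succ (bar a))).
  rewrite mem_ball => He /andP[Sp Hp].
  have Hap : nbwalk (out (src a)) (a :: p) by rewrite /= inE eqxx path_nb.
  have [|Hph | [p' Ep]] := nbwalk_step (h := h) Hap; first by rewrite He.
    move: Sp; rewrite leq_eqVlt => /orP[/eqP Sp | Sp]; [right | left].
      have [|s [Hs Es Ss]] := extend_back (h := a) (p := rcons p h) ext Hph.
        by rewrite size_rcons Sp prednK.
      apply/mapP; exists s; last by rewrite Es last_rcons.
      by rewrite mem_ball Hs Ss andbT; lia.
    apply/mapP; exists (rcons p h); last by rewrite endv_rcons.
    by rewrite mem_ball size_rcons Sp -path_nb; case/andP: Hph.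
  case: p' Ep => [[Ea _] | k p' [_ Ep]]; [right | left].
    by apply/mapP; exists [::]; rewrite ?mem_ball // Ea.
  rewrite Ep in Hp Sp; have [_ Ep'] := nbwalk_belast (nbwalk_succ Hp).
  apply/mapP; exists p'; last by rewrite Ep'.
  rewrite -cats1 in Hp; rewrite mem_ball (nbwalk_catl Hp) andbT.
  by move: Sp; rewrite size_rcons => /ltnW.
rewrite mem_cat tgt_bar => /orP[]/mapP[p Hp He].
  by rewrite mem_cat; apply/orP; exact: half He Hp.
rewrite -(tgt_bar e) in He; have := half _ _ He Hp; rewrite tgt_bar barK mem_cat.
by case=> ->; rewrite ?orbT.
Qed.

Lemma moore_tree_root e : src e \in moore_tree e.
Proof.
rewrite /moore_tree; case: ifP => _; first by apply/mapP; exists [::]; rewrite ?mem_ball.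
rewrite mem_cat; apply/orP; right; apply/mapP.
by exists [::]; rewrite ?mem_ball // tgt_bar.
Qed.

Lemma extendable_full e : connected src bar -> extendable ->
  forall y, y \in moore_tree e.
Proof.
move=> conn ext y; have /connectP[s] := conn (src e) y.
elim: s (src e) (moore_tree_root e) => [|z s IH] x Hx /=; first by move=> _ ->.
case/andP=> /existsP[h /andP[/eqP Eh /eqP Et]]; apply: IH.
by rewrite -Et; apply: moore_tree_closed => //; rewrite Eh.
Qed.

(** The end of a walk of length r + 1 is also reached by a shorter tree walk; the two have total
    length at most [g], so [geodesic_pair] closes them up. *)
Lemma full_extendable : (forall e y, y \in moore_tree e) -> extendable.
Proof.
move=> full [//|h p] [Sp] /andP[_ Hp].
have Hw : nbwalk (out (src h)) (h :: p) by rewrite /= inE eqxx.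
have ext q : nbwalk (out (src h)) q -> size q < size (h :: p) ->
    size (h :: p) + size q <= g -> endv (src h) (h :: p) = endv (src h) q ->
    exists q, closed_geodesic ((h :: p) ++ q) /\ size ((h :: p) ++ q) = g.
  move=> Hq lt le E; exists (inv q).
  have C : closed_geodesic ((h :: p) ++ inv q).
    by apply: (geodesic_pair Hw Hq E) le; apply: contraTneq lt => <-; rewrite ltnn.
  split=> //; apply/eqP; rewrite eqn_leq {1}size_cat size_inv le.
  by case: girth => _; apply.
have := full h (tgt (last h p)); rewrite /moore_tree; case: ifPn => [og | eg].
  case/mapP=> q; rewrite mem_ball => /andP[Sq Hq] E.
  by apply: (ext q Hq); rewrite /= ?endv_cons ?Sp //; move: (size q) Sq => j; lia.
have r0 := even_half_gt0 eg.
rewrite mem_cat => /orP[]/mapP[q]; rewrite mem_ball => /andP[Sq Hq] E; last first.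
  move/nbwalk_succ: Hq E; rewrite tgt_bar => Hq E.
  by apply: (ext q Hq); rewrite /= ?endv_cons ?Sp //; move: (size q) Sq => j; lia.
(* In the half beyond [h], [p] and [q] share their ends and have total length at most 2r - 1, so
   they would coincide; but [p] has length r and [q] at most r - 1. *)
have Hp' : nbwalk (out (tgt h)) p by apply: nbwalk_succ; rewrite -path_nb.
have Epq : p = q.
  apply: (short_unique Hp' (nbwalk_succ Hq)).
    by rewrite -E -(endv_cons (src h)).
  by rewrite Sp; move: (size q) Sq => j; lia.
by move: Sq; rewrite -Epq Sp; lia.
Qed.

Lemma card_geodesics_moore : connected src bar ->
  #|geodesics| = #|V| * d * (d - 1) ^ (g %/ 2) <-> is_moore src bar.
Proof.
move=> conn; have [a _] := girth_darts.
have V0 : 0 < #|V| by apply/card_gt0P; exists (src a).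
have -> : #|geodesics| = #|V| * d * (d - 1) ^ (g %/ 2) <-> regular src d /\ extendable.
  rewrite -card_darts_eq extendableP; have [_ H] := card_geodesics.
  split=> [/eqP|[/eqP ED /allP sub]]; last by apply/eqP; rewrite H ED.
  by rewrite H => /andP[/eqP-> /allP].
split=> [[reg ext]|[_ [k [g' [reg [[[s [Hs <-]] min] card]]]]]].
  split=> //; exists d, g; split=> //; split=> //.
  by apply/(moore_tree_full a reg); exact: extendable_full.
(* The girth is unique, so the parameters of the Moore graph are [d] and [g]. *)
have Sg : size s = g.
  apply/eqP; rewrite eqn_leq; case: girth => -[t [Ht <-]] min'.
  by rewrite min //= min'.
rewrite Sg in card; rewrite (regular_maxdeg V0 reg); split=> //.
by apply: full_extendable => e; apply/(moore_tree_full e reg).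
Qed.

End Girth.
End KissingNumber.

(** * The rational form of the bound *)

Local Open Scope ring_scope.

Theorem theorem1p1 (V D : finType) (src : D -> V) (rev : D -> D)
    (rev_inv : involutive rev) (rev_nofix : forall e, rev e != e)
    (g : nat) :
  connected src rev -> is_girth src rev g ->
  let n := #|V| in let d := maxdeg src in
  ((kiss src rev g)%:R <= ((n * d * (d - 1) ^ (g %/ 2))%N)%:R / (g%:R : rat))
  /\ ((kiss src rev g)%:R = ((n * d * (d - 1) ^ (g %/ 2))%N)%:R / (g%:R : rat)
      <-> is_moore src rev).
Proof.
move=> conn girth n d.
have g0 : (0 : rat) < g%:R by rewrite ltr0n (girth_gt0 girth).
have kissE := kiss_geodesics rev_inv rev_nofix girth.
rewrite ler_pdivlMr // -natrM kissE ler_nat; split.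
  by case: (card_geodesics rev_inv rev_nofix girth).
rewrite -(card_geodesics_moore rev_inv rev_nofix girth conn) -kissE.
split=> [E | <-]; last by rewrite natrM mulfK // gt_eqF.
by apply/eqP; rewrite -(eqr_nat rat) natrM E divfK // gt_eqF.
Qed.
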